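(* Let $n,\alpha,\beta\ge1$ be integers and let $u=C(n,\alpha)\in\{a<z\}^n$ and $v=C(n,\beta)\in\{b<z\}^n$ be Christoffel words. There exist positive integers $x,y$ such that $\alpha x+\beta y=n$ if and only if $u$ and $\widetilde v$ are perfectly superimposable.
   Context: For coprime $s,t\in\{0,1,2,\dots\}$ and $n=s+t$, the Christoffel word over the ordered alphabet $\{a<z\}$ with $s$ occurrences of $a$ and $t$ occurrences of $z$ is $u=u[0]u[1]\cdots u[n-1]$ with $u[i]=a$ if $((i+1)t \bmod n)>(it\bmod n)$ and $u[i]=z$ otherwise. It is denoted $C(n,s)$; calling $C(n,s)$ a Christoffel word presupposes $\gcd(n,s)=1$. Over $\{b<z\}$ the definition is the same with $b$ in place of $a$. $\widetilde v$ denotes the reversal (mirror image) of $v$. Two words $u\in\{a,z\}^n$ and $v'\in\{b,z\}^n$ of the same length are perfectly superimposable if no position carries the letter $a$ in $u$ and the letter $b$ in $v'$.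
   Formalization: For n = 1 the displayed formula gives C(1,1) = z, contradicting its one occurrence of a and making the claim false for n = α = β = 1; here C(1,1) is taken to be the single letter a (respectively b). *)

(* Defs.v *)
From mathcomp Require Import all_boot.

Set Implicit Arguments.
Unset Strict Implicit.
Unset Printing Implicit Defensive.

(* Words over {a < z} and over {b < z} are both words over this common type. *)
Inductive letter := La | Lb | Lz.

(* C(n, s) over {lo < hi}, with t = n - s; meaningful when s <= n and
   coprime n s.  The test t == 0 matters only for s = n = 1, where the strict
   inequality between residues modulo 1 always fails although the word has
   s = 1 occurrence of lo. *)
Definition christoffel (A : Type) (lo hi : A) (n s : nat) : n.-tuple A :=
  let t := n - s in
  [tuple if (t == 0) || ((i * t) %% n < (i.+1 * t) %% n) then lo else hi
  | i < n].

Definition perfectly_superimposable (n : nat) (u v : n.-tuple letter) : Prop :=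
  forall i : 'I_n, ~ (tnth u i = La /\ tnth v i = Lb).

(* Main.v *)
Require Import Defs.
From mathcomp Require Import all_boot.
From mathcomp Require Import zify.

Set Implicit Arguments.
Unset Strict Implicit.
Unset Printing Implicit Defensive.

(** Both words carry their low letter at position [i] exactly when there are
    [p < alpha] and [0 < q <= beta] with [n] dividing [i alpha + p] and
    [i beta + q].  If [alpha x + beta y = n] with [x, y > 0], then [n] divides
    [p x + q y], which lies strictly between [0] and [n].  Conversely, if
    [d = gcd(alpha, beta) > 1], the pair [(alpha / d, beta / d)] gives a
    collision.  If [d = 1], take [p < alpha] with
    [p beta + n = alpha q]: if [q <= beta] this is a collision, and otherwise
    [x = q - beta], [y = alpha - p] is a solution. *)

(** By the Chinese remainder theorem some multiple of [a] is congruent to [-c] modulo [m]; dividing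
    it by [a] gives [i]. *)
Lemma coprime_dvdn_affine (m a c : nat) :
  0 < m -> coprime m a -> exists2 i, i < m & m %| i * a + c.
Proof.
move=> m_gt0 cop_ma.
have cop_am : coprime a m by rewrite coprime_sym.
(* [c * m.-1] represents [-c] modulo [m]. *)
pose x := chinese a m 0 (c * m.-1).
have a_dvd_x : a %| x by rewrite /dvdn chinese_modl // mod0n.
exists (x %/ a %% m); first by rewrite ltn_mod.
rewrite /dvdn -modnDml modnMml divnK // modnDml.
rewrite -modnDml chinese_modr // modnDml -{2}[c]muln1 -mulnDr addn1 prednK //.
by rewrite modnMl.
Qed.

(** For [0 < t], adding [t] to the residue [r] of [i * t] avoids wrapping around [n] exactly when
    [r < n - t = s]. As [t] is [-s] modulo [n], [r] is the only [p < n] with [n] dividing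
    [i * s + p]. *)
Lemma tnth_christoffel_lo (A : Type) (lo hi : A) (n s : nat) (i : 'I_n) :
  lo <> hi -> 0 < s -> s <= n ->
  tnth (christoffel lo hi n s) i = lo <-> exists2 p, p < s & n %| i * s + p.
Proof.
move=> lo_hi s_gt0 s_le_n; rewrite tnth_mktuple.
have n_gt0 : 0 < n by apply: leq_trans s_gt0 _.
set t := n - s; set r := i * t %% n.
have r_lt_n : r < n by rewrite ltn_mod.
have eq_test : (t == 0) || (r < i.+1 * t %% n) = (r < s).
  rewrite mulSn addnC -modnDml -/r.
  (* Here [t = 0] means [s = n], so [r < s] always holds. *)
  case: (eqVneq t 0) => [t0|t_neq0] /=; first by lia.
  case: (ltnP (r + t) n) => [lt_rt | le_rt]; first by rewrite modn_small //; lia.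
  have -> : r + t = (r + t - n) + n by rewrite subnK.
  by rewrite modnDr modn_small; lia.
have dvd_r : n %| i * s + r.
  by rewrite /dvdn modnDmr -mulnDr subnKC // modnMl.
rewrite eq_test; split=> [|[p p_lt_s dvd_p]].
  by case: ltnP => [r_lt_s _|_ /esym//]; exists r.
suff -> : r = p by rewrite p_lt_s.
have /eqP : i * s + r == i * s + p %[mod n] by rewrite (eqP dvd_r) (eqP dvd_p).
move/eqP; rewrite eqn_modDl !modn_small //; first by move/eqP.
exact: leq_trans s_le_n.
Qed.

(** Reversal replaces [p] by [q = s - p], because [(n - i.+1) * s + p] and [i * s + (s - p)] add up
    to [n * s]. This shifts the range from [0 <= p < s] to [0 < q <= s]. *)
Lemma tnth_rev_christoffel_lo (A : Type) (lo hi : A) (n s : nat) (i : 'I_n) :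
  lo <> hi -> 0 < s -> s <= n ->
  tnth (rev_tuple (christoffel lo hi n s)) i = lo <->
  exists q, [/\ 0 < q, q <= s & n %| i * s + q].
Proof.
move=> lo_hi s_gt0 s_le_n.
have -> : tnth (rev_tuple (christoffel lo hi n s)) i =
          tnth (christoffel lo hi n s) (rev_ord i).
  by rewrite !(tnth_nth lo) [LHS]nth_rev size_tuple.
rewrite tnth_christoffel_lo //=.
have dvd_rev p : p <= s -> n %| (n - i.+1) * s + p = (n %| i * s + (s - p)).
  move=> p_le_s; have sum_ns : (n - i.+1) * s + p + (i * s + (s - p)) = n * s.
    have := ltn_ord i; nia.
  apply/idP/idP => dvd_n; have := dvdn_mulr s (dvdnn n); rewrite -sum_ns.
    by rewrite dvdn_addr.
  by rewrite dvdn_addl.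
split=> [[p p_lt_s]|[q [q_gt0 q_le_s dvd_q]]].
  by rewrite dvd_rev 1?ltnW // => dvd_p; exists (s - p); split=> //; lia.
exists (s - q); first by lia.
by rewrite dvd_rev ?leq_subr // subKn.
Qed.

Definition collision (n a b : nat) : Prop :=
  exists i p q, [/\ i < n, p < a, 0 < q <= b, n %| i * a + p & n %| i * b + q].

(** Choose [i] with [n] dividing [i * a + p]. Then [a * (i * b + q)] is congruent to
    [b * (i * a + p)], hence to 0, and [a] cancels. *)
Lemma collision_of_congruent (n a b p q : nat) :
  0 < n -> coprime n a -> p < a -> 0 < q <= b -> a * q = b * p %[mod n] ->
  collision n a b.
Proof.
move=> n_gt0 cop_na p_lt_a q_bnd eq_qp.
have [i i_lt_n dvd_p] := coprime_dvdn_affine p n_gt0 cop_na.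
exists i, p, q; split=> //.
rewrite -(Gauss_dvdr _ cop_na) mulnDr /dvdn -modnDmr eq_qp modnDmr.
have -> : a * (i * b) + b * p = b * (i * a + p) by lia.
exact: dvdn_mull.
Qed.

Lemma solution_or_collision (n a b : nat) :
  0 < n -> 0 < a -> 0 < b -> coprime n a ->
  (exists x y, [/\ 0 < x, 0 < y & a * x + b * y = n]) \/ collision n a b.
Proof.
move=> n_gt0 a_gt0 b_gt0 cop_na.
have [cop_ab | ncop_ab] := boolP (coprime a b).
  have [p p_lt_a /dvdnP[q def_q]] := coprime_dvdn_affine n a_gt0 cop_ab.
  have [b_lt_q | q_le_b] := ltnP b q.
    (* From [p * b + n = q * a]: [a * (q - b) + b * (a - p) = a * q - b * p = n]. *)
    by left; exists (q - b), (a - p); split; nia.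
  right; apply: (@collision_of_congruent n a b p q) => //.
    by rewrite q_le_b andbT; nia.
  by rewrite mulnC -def_q modnDr mulnC.
right; pose d := gcdn a b.
have d_gt1 : 1 < d by rewrite ltn_neqAle eq_sym ncop_ab gcdn_gt0 a_gt0.
apply: (@collision_of_congruent n a b (a %/ d) (b %/ d)) => //.
- exact: ltn_Pdiv.
- by rewrite divn_gt0 ?gcdn_gt0 ?a_gt0 // leq_div dvdn_leq ?dvdn_gcdr.
- by rewrite !muln_divA ?dvdn_gcdl ?dvdn_gcdr // mulnC.
Qed.

Lemma solution_no_collision (n a b x y : nat) :
  0 < x -> 0 < y -> a * x + b * y = n -> ~ collision n a b.
Proof.
move=> x_gt0 y_gt0 def_n [i [p [q [_ p_lt_a /andP[q_gt0 q_le_b] dvd_p dvd_q]]]].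
have : n %| (i * a + p) * x + (i * b + q) * y by rewrite dvdn_add ?dvdn_mulr.
have -> : (i * a + p) * x + (i * b + q) * y = i * n + (p * x + q * y).
  by rewrite -def_n; lia.
(* The sum is positive by its term [q * y], and below [n] since [p * x < a * x] and
   [q * y <= b * y]. *)
rewrite dvdn_addr ?dvdn_mull // => /dvdn_leq; nia.
Qed.

Theorem theorem5p1 (n alpha beta : nat)
    (n_gt0 : 0 < n) (alpha_gt0 : 0 < alpha) (beta_gt0 : 0 < beta)
    (alpha_le_n : alpha <= n) (beta_le_n : beta <= n)
    (cop_alpha : coprime n alpha) (cop_beta : coprime n beta) :
  (exists x y : nat, [/\ 0 < x, 0 < y & alpha * x + beta * y = n]) <->
  perfectly_superimposable (christoffel La Lz n alpha)
    (rev_tuple (christoffel Lb Lz n beta)).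
Proof.
split=> [[x [y [x_gt0 y_gt0 def_n]]] i [u_i v_i] | superimposable].
  apply: (solution_no_collision x_gt0 y_gt0 def_n).
  have /tnth_christoffel_lo[//|//|//|p p_lt dvd_p] := u_i.
  have /tnth_rev_christoffel_lo[//|//|//|q [q_gt0 q_le dvd_q]] := v_i.
  by exists i, p, q; split=> //; apply/andP.
have [//|[i [p [q [i_lt_n p_lt /andP[q_gt0 q_le] dvd_p dvd_q]]]]] :=
  solution_or_collision n_gt0 alpha_gt0 beta_gt0 cop_alpha.
case: (superimposable (Ordinal i_lt_n)); split.
  by apply/tnth_christoffel_lo => //; exists p.
by apply/tnth_rev_christoffel_lo => //; exists q.
Qed.
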